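(* Let $n\ge1$, $Q=2n+2$, and let $\alpha,\gamma$ be real numbers with $Q+\gamma>0$ and $0<\alpha<Q$. Then the fractional Hardy operator $\mathcal{H}_\alpha$ on the Heisenberg group $\mathbb{H}^n$ satisfies $$\left\|\mathcal{H}_\alpha\right\|_{L^1(\mathbb{H}^n)\to L^{(Q+\gamma)/(Q-\alpha),\infty}(\mathbb{H}^n,|x|_h^{\gamma})}=\left(\frac{\omega_Q}{Q+\gamma}\right)^{(Q-\alpha)/(Q+\gamma)}.$$
   Context: The Heisenberg group $\mathbb{H}^n$ is, as a manifold, $\mathbb{R}^{2n+1}$; its Haar measure is Lebesgue measure $dx$ on $\mathbb{R}^{2n+1}$, its dilations are $\delta_r(x_1,\dots,x_{2n},x_{2n+1})=(rx_1,\dots,rx_{2n},r^2x_{2n+1})$ for $r>0$, and its homogeneous dimension is $Q=2n+2$. The homogeneous norm is $|x|_h=\big[\big(\sum_{i=1}^{2n}x_i^2\big)^2+x_{2n+1}^2\big]^{1/4}$. Put $B(0,1)=\{x:|x|_h<1\}$, $\Omega_Q=|B(0,1)|$ (Lebesgue measure) and $\omega_Q=Q\,\Omega_Q$. For $0<\alpha<Q$ the $n$-dimensional fractional Hardy operator is $$\mathcal{H}_\alpha f(x)=\frac{1}{|x|_h^{Q-\alpha}}\int_{|y|_h<|x|_h}f(y)\,dy,\qquad x\in\mathbb{H}^n\setminus\{0\},$$ for locally integrable $f$. $L^1(\mathbb{H}^n)$ is the usual unweighted Lebesgue space. For a positive measurable weight $w$ (defined almost everywhere) and an exponent $s>0$,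 $$\|f\|_{L^{s,\infty}(\mathbb{H}^n,w)}=\sup_{\lambda>0}\lambda\Big(\int_{\{x:|f(x)|>\lambda\}}w(x)\,dx\Big)^{1/s}.$$ The operator norm $\|T\|_{X\to Y}$ is the supremum of $\|Tf\|_Y/\|f\|_X$ over $f\in X$ with $0<\|f\|_X<\infty$. *)

(* Defs.v *)
From HB Require Import structures.
From mathcomp Require Import all_boot all_order all_algebra.
From mathcomp Require Import all_classical all_reals all_analysis.

Set Implicit Arguments.
Unset Strict Implicit.
Unset Printing Implicit Defensive.

Import Order.TTheory GRing.Theory Num.Theory.
Import numFieldNormedType.Exports.

Local Open Scope classical_set_scope.
Local Open Scope ring_scope.
Local Open Scope ereal_scope.

Lemma product_measure_sigma_finite d1 d2 (T1 : measurableType d1)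
    (T2 : measurableType d2) (R : realType)
    (m1 : {sigma_finite_measure set T1 -> \bar R})
    (m2 : {sigma_finite_measure set T2 -> \bar R}) :
  sigma_finite [set: T1 * T2] (m1 \x m2).
Proof.
have /sigma_finiteP[F [TF ndF Foo]] := sigma_finiteT m1.
have /sigma_finiteP[G [TG ndG Goo]] := sigma_finiteT m2.
exists (fun k => F k `*` G k).
  rewrite -setXTT TF TG predeqE => -[x y]; split.
    move=> [/= [k _ Fkx] [l _ Gly]]; exists (maxn k l) => //; split.
    - by move: x Fkx; exact/subsetPset/ndF/leq_maxl.
    - by move: y Gly; exact/subsetPset/ndG/leq_maxr.
  by move=> [k _ []/= ? ?]; split; exists k.
move=> k; have [? ?] := Foo k; have [? ?] := Goo k.
split; first exact: measurableX.
by rewrite product_measure1E// lte_mul_pinfty// ge0_fin_numE.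
Qed.

Section tuple_measure.
Context d (T : measurableType d) (R : realType).
Variable mu : {sigma_finite_measure set T -> \bar R}.

Definition cons_pair m (p : T * m.-tuple T) : m.+1.-tuple T :=
  [tuple of p.1 :: p.2].

Lemma measurable_cons_pair m :
  measurable_fun [set: T * m.-tuple T] (@cons_pair m).
Proof. exact: (measurable_cons measurable_fst measurable_snd). Qed.

Section cons_measure.
Context (m : nat) (nu : {sigma_finite_measure set (m.-tuple T) -> \bar R}).

Definition cons_measure : set (m.+1.-tuple T) -> \bar R :=
  pushforward (mu \x nu) (@cons_pair m).

HB.instance Definition _ := Measure.copy cons_measure
  (measure_function_pushforward__canonical__measure_function_Measure
    (mu \x nu) (@measurable_cons_pair m)).

Lemma cons_measure_sigma_finite : sigma_finite [set: m.+1.-tuple T] cons_measure.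
Proof.
have [F TF Foo] := product_measure_sigma_finite mu nu.
pose g (t : m.+1.-tuple T) : T * m.-tuple T :=
  (tnth t ord0, [tuple of behead t]).
have mg : measurable_fun [set: m.+1.-tuple T] g.
  apply/measurable_fun_pairP; split.
    exact: measurable_tnth.
  exact: measurable_behead.
have gK p : g (cons_pair p) = p.
  by case: p => x t; congr pair; exact: val_inj.
exists (fun k => g @^-1` F k).
  by rewrite -preimage_bigcup -TF preimage_setT.
move=> k; have [mF Fk] := Foo k; split.
  by rewrite -[X in measurable X]setTI; exact: mg.
rewrite /cons_measure /pushforward -comp_preimage.
by rewrite (_ : g \o @cons_pair m = id)//; apply/funext.
Qed.

HB.instance Definition _ := @Measure_isSigmaFinite.Build _ _ _
  cons_measure cons_measure_sigma_finite.

End cons_measure.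

Fixpoint tuple_measure (m : nat) :
    {sigma_finite_measure set (m.-tuple T) -> \bar R} :=
  if m is m'.+1 then cons_measure (tuple_measure m')
  else dirac ([tuple] : 0.-tuple T).

Lemma tuple_measure_box m (A : 'I_m -> set T) :
  (forall i, measurable (A i)) ->
  tuple_measure m [set x | forall i, A i (tnth x i)] =
  \prod_(i < m) mu (A i).
Proof.
elim: m A => [|m IH] A mA.
  by rewrite big_ord0 /= diracE mem_set// => -[].
rewrite big_ord_recl /= /cons_measure /pushforward.
rewrite (_ : _ @^-1` _ = A ord0 `*`
    [set x : m.-tuple T | forall i, A (lift ord0 i) (tnth x i)]); last first.
  apply/seteqP; split => -[x t] /= H.
    split; first exact: (H ord0).
    by move=> i; have := H (lift ord0 i); rewrite tnthS.
  move=> i; have [j ->|->] := unliftP ord0 i; last exact: H.1.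
  by rewrite tnthS; exact: H.2.
rewrite product_measure1E//.
  congr (_ * _); apply: (IH (fun i => A (lift ord0 i))) => i; exact: mA.
rewrite (_ : [set x | _] =
    \bigcap_(i in [set: 'I_m]) (fun x : m.-tuple T => tnth x i) @^-1` A (lift ord0 i)).
  apply: fin_bigcap_measurable => // i _.
  by rewrite -[X in measurable X]setTI; exact: measurable_tnth.
by apply/seteqP; split => x /= H i; [move=> _; exact: H|exact: H].
Qed.

End tuple_measure.

(* Lebesgue measure on the Borel sets of R^m. *)
Definition lebesgue_tuple (R : realType) (m : nat) :
    {sigma_finite_measure set (m.-tuple (measurableTypeR R)) -> \bar R} :=
  tuple_measure (@lebesgue_measure R) m.

(* ||f||_{L^{s,oo}(w dmu)} *)
Definition weak_Lnorm d (T : measurableType d) (R : realType)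
    (mu : {measure set T -> \bar R}) (w : T -> R) (s : R) (f : T -> R) : \bar R :=
  ereal_sup [set
    l%:E * (\int[mu]_(x in [set x | (l < `|f x|)%R]) (w x)%:E) `^ s^-1
    | l in [set l : R | (0 < l)%R]].

(* Supremum of ||Op f||_Y / ||f||_X over f in X with 0 < ||f||_X < +oo. *)
Definition opnorm (T : Type) (R : realType) (X : set (T -> R)) (normX normY : (T -> R) -> \bar R)
    (Op : (T -> R) -> T -> R) : \bar R :=
  ereal_sup [set normY (Op f) / normX f
            | f in X `&` [set f | 0 < normX f < +oo]].

Section Heisenberg.
Context (R : realType) (n : nat).

(* The underlying manifold R^(2n+1) of the Heisenberg group; coordinates are
   indexed from 0, so the central one is [ord_max]. *)
Definition Heis := (2 * n).+1.-tuple (measurableTypeR R).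

Definition hQ : nat := (2 * n + 2)%N.

Definition haar : {sigma_finite_measure set Heis -> \bar R} :=
  lebesgue_tuple R (2 * n).+1.

Definition hcoord (x : Heis) (i : 'I_(2 * n).+1) : R := tnth x i.

Definition hnorm (x : Heis) : R :=
  (((\sum_(i < 2 * n) hcoord x (widen_ord (leqnSn _) i) ^+ 2) ^+ 2
    + hcoord x ord_max ^+ 2) `^ 4^-1)%R.

Definition hball : set Heis := [set x | (hnorm x < 1)%R].

Definition OmegaQ : \bar R := haar hball.

Definition omegaQ : \bar R := hQ%:R%:E * OmegaQ.

(* The value at the origin, where the operator is not defined, is
   immaterial: the origin is negligible. *)
Definition hardy (alpha : R) (f : Heis -> R) (x : Heis) : R :=
  ((hnorm x `^ (hQ%:R - alpha))^-1
   * \int[haar]_(y in [set y | hnorm y < hnorm x]) f y)%R.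

End Heisenberg.

(* Main.v *)
(* The dilations multiply the homogeneous norm by r and Haar measure by r^Q. Scaling thus turns
   G(a) = int_{a <= |x| < 1} |x|^gamma dx into a solution of G(ab) = G(b) + b^(Q+gamma) G(a);
   since G(ab) is symmetric, G(a) = C (1 - a^(Q+gamma)), and comparing |x|^gamma with its
   extreme values on thin shells gives C = omega_Q / (Q + gamma), without polar coordinates.
   Upper bound: |H f(x)| <= ||f||_1 |x|^(alpha-Q), so {|H f| > l} lies in the punctured ball of
   radius (||f||_1 / l)^(1/(Q-alpha)), where the weight has mass C times a power of the radius.
   Lower bound: for f the indicator of the unit ball the pointwise bound is an equality when
   |x| >= 1, and the level sets contain shells 1 <= |x| < r, with r tending to infinity. *)

Require Import Defs.
From HB Require Import structures.
From mathcomp Require Import all_boot all_order all_algebra.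
From mathcomp Require Import all_classical all_reals all_analysis.
From mathcomp Require Import measurable_realfun ring lra.

Set Implicit Arguments.
Unset Strict Implicit.
Unset Printing Implicit Defensive.

Import Order.TTheory GRing.Theory Num.Theory.
Import numFieldNormedType.Exports.

Local Open Scope classical_set_scope.
Local Open Scope ring_scope.

(** * First-order inequalities and the functional equation *)

(** Lets [t] tend to 0 in an estimate with linear error, so that no derivative has to be taken. *)
Lemma ler_addgt0_lin (R : realFieldType) (x y k e : R) : 0 < e ->
  (forall t, 0 < t -> t <= e -> x <= y + t * k) -> x <= y.
Proof.
move=> e0 H; rewrite leNgt; apply/negP => yx.
have k1 : 0 < `|k| + 1 by rewrite ltr_wpDl.
(* With this choice [t * k] is less than half the gap [x - y]. *)
pose t := Num.min e ((x - y) / (2 * (`|k| + 1))).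
have t0 : 0 < t by rewrite lt_min e0 divr_gt0 ?subr_gt0 ?mulr_gt0.
have te : t <= e by rewrite ge_min lexx.
have tk : t * (2 * (`|k| + 1)) <= x - y.
  by rewrite -ler_pdivlMr ?mulr_gt0// ge_min lexx orbT.
have := H _ t0 te; have := ler_norm k; nra.
Qed.

(** A division-free form of [1 - expR (- x) >= x / (1 + x)], the counterpart of
    [1 - expR (- x) <= x]. *)
Lemma expRN_le (R : realType) (x : R) : 0 <= x -> expR (- x) * (1 + x) <= 1.
Proof.
move=> x0; apply: (@le_trans _ _ (expR (- x) * expR x)).
  by rewrite ler_wpM2l ?expR_ge0// expR_ge1Dx.
by rewrite expRN mulVf// gt_eqF// expR_gt0.
Qed.

(* Exchanging [t] and [u] in the functional equation makes [G] a multiple of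
   [1 - expR (- (t * s))]; the bounds give its derivative at [0]. *)
Lemma radial_functional_equation (R : realType) (G : R -> R) (s c q o : R) :
  0 < s -> 0 <= c -> 0 <= q -> 0 <= o ->
  (forall t u, 0 <= t -> 0 <= u -> G (t + u) = G t + expR (- (t * s)) * G u) ->
  (forall t, 0 <= t -> expR (- (c * t)) * ((1 - expR (- (q * t))) * o) <= G t
                    <= expR (c * t) * ((1 - expR (- (q * t))) * o)) ->
  forall u, 0 <= u -> G u = q * o / s * (1 - expR (- (u * s))).
Proof.
move=> s0 c0 q0 o0 GD Gb u u0.
set K := 1 - _.
have K0 : 0 <= K by rewrite subr_ge0 expR_le1 oppr_le0 mulr_ge0// ltW.
have G0 t : 0 <= t -> 0 <= G t.
  move=> t0; have /andP[+ _] := Gb _ t0; apply: le_trans.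
  by rewrite !mulr_ge0 ?expR_ge0// subr_ge0 expR_le1 oppr_le0 mulr_ge0.
have GK t : 0 <= t -> G u * (1 - expR (- (t * s))) = K * G t.
  move=> t0; have := GD _ _ t0 u0; rewrite addrC GD// /K.
  lra.
suff : G u * s = K * q * o by move=> E; rewrite mulrC !mulrA -E mulfK// gt_eqF.
have Gu0 := G0 _ u0.
(* Up to this bound on [t] the factor [1 - c * t], which minorizes [expR (- (c * t))], is
   nonnegative. *)
have e0 : 0 < (c + 1)^-1 by rewrite invr_gt0 ltr_wpDl.
have ct t : 0 < t -> t <= (c + 1)^-1 -> c * t <= 1.
  by move=> t0; rewrite -div1r ler_pdivlMr ?ltr_wpDl//; nra.
apply/le_anti/andP; split.
(* [k] collects the terms of order [t] in [G u * s * (1 - c * t) <= (1 + t * s) * (K * q * o)]. *)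
- apply: (ler_addgt0_lin (k := s * (K * q * o) + G u * s * c) e0) => t t0 /(ct _ t0) {}ct.
  have /andP[_ Gt] := Gb _ (ltW t0).
  have E1 : G u * (t * s) <= K * G t * (1 + t * s).
    have ts0 : 0 <= t * s by nra.
    have E : G u * (expR (- (t * s)) * (1 + t * s)) <= G u * 1 by rewrite ler_wpM2l// expRN_le.
    rewrite -(GK _ (ltW t0)); lra.
  have E2 : G t * (1 - c * t) <= q * t * o.
    apply: (@le_trans _ _ (expR (c * t) * (q * t * o) * expR (- (c * t)))).
      apply: ler_pM; rewrite ?subr_ge0 ?G0 ?(ltW t0)//; last first.
        exact: expR_ge1Dx (- (c * t)).
      apply: (le_trans Gt); rewrite ler_wpM2l ?expR_ge0// ler_wpM2r//.
      by have := expR_ge1Dx (- (q * t)); lra.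
    by rewrite mulrAC expRN mulfV ?mul1r// gt_eqF// expR_gt0.
  have E3 : t * (G u * s * (1 - c * t)) <= t * ((1 + t * s) * (K * q * o)).
    apply: (@le_trans _ _ (K * (1 + t * s) * (G t * (1 - c * t)))); first by nra.
    apply: (@le_trans _ _ (K * (1 + t * s) * (q * t * o))); last by nra.
    by rewrite ler_wpM2l// mulr_ge0//; nra.
  rewrite (ler_pM2l t0) in E3.
  have -> : K * q * o + t * (s * (K * q * o) + G u * s * c) =
    (1 + t * s) * (K * q * o) + G u * s * (c * t) by ring.
  lra.
(* Here the estimate to expand is [(1 - c * t) * (K * q * o) <= G u * s * (1 + q * t)]. *)
- apply: (ler_addgt0_lin (k := G u * s * q + K * q * o * c) e0) => t t0 /(ct _ t0) {}ct.
  have /andP[Gt _] := Gb _ (ltW t0).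
  have E1 : K * G t <= G u * (t * s).
    rewrite -(GK _ (ltW t0)) ler_wpM2l//.
    by have := expR_ge1Dx (- (t * s)); lra.
  have E2 : (1 - c * t) * (q * t) * o <= G t * (1 + q * t).
    apply: (@le_trans _ _
      (expR (- (c * t)) * ((1 - expR (- (q * t))) * o) * (1 + q * t))); last first.
      by rewrite ler_wpM2r// addr_ge0// mulr_ge0// (ltW t0).
    rewrite -!mulrA; apply: ler_pM; rewrite ?subr_ge0//; first by rewrite !mulr_ge0// (ltW t0).
      by have := expR_ge1Dx (- (c * t)).
    rewrite (mulrC o) !mulrA ler_wpM2r//.
    have qt0 : 0 <= q * t by rewrite mulr_ge0// (ltW t0).
    by have := expRN_le qt0; lra.
  have E3 : t * ((1 - c * t) * (K * q * o)) <= t * (G u * s * (1 + q * t)).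
    apply: (@le_trans _ _ (K * (G t * (1 + q * t)))).
      have -> : t * ((1 - c * t) * (K * q * o)) = K * ((1 - c * t) * (q * t) * o) by ring.
      by rewrite ler_wpM2l.
    have qt0 : 0 <= q * t by rewrite mulr_ge0// (ltW t0).
    by nra.
  rewrite (ler_pM2l t0) in E3.
  have -> : G u * s + t * (G u * s * q + K * q * o * c) =
    G u * s * (1 + q * t) + (c * t) * (K * q * o) by ring.
  lra.
Qed.

Local Open Scope ereal_scope.

(** * Change of variables and scaling of Lebesgue measure *)

(** The hypothesis makes [mu] equal to [c] times its own pushforward under [phi]. *)
Lemma ge0_integral_dilation d (T : measurableType d) (R : realType)
    (mu : {measure set T -> \bar R}) (phi : T -> T) (c : {nonneg R})
    (D : set T) (f : T -> \bar R) :
  measurable_fun setT phi ->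
  (forall A, measurable A -> mu A = c%:num%:E * mu (phi @^-1` A)) ->
  measurable D -> measurable_fun D f -> (forall x, D x -> 0 <= f x) ->
  \int[mu]_(x in D) f x = c%:num%:E * \int[mu]_(x in phi @^-1` D) f (phi x).
Proof.
move=> mphi muE mD mf f0.
pose nu : {measure set T -> \bar R} :=
  measure_function_pushforward__canonical__measure_function_Measure mu mphi.
rewrite (@eq_measure_integral _ _ _ _ (mscale c nu)); last first.
  by move=> A mA _; rewrite muE.
rewrite ge0_integral_mscale//; congr (_ * _).
by rewrite ge0_integral_pushforward// => x; rewrite inE => /f0.
Qed.

(* The integral over an arbitrary set is a supremum over simple functions, so monotonicity
   survives without measurability; this avoids showing that level sets are measurable. *)
Lemma ge0_integral_subset d (T : measurableType d) (R : realType)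
    (mu : {measure set T -> \bar R}) (A B : set T) (f : T -> \bar R) :
  (forall x, 0 <= f x) -> A `<=` B ->
  \int[mu]_(x in A) f x <= \int[mu]_(x in B) f x.
Proof.
move=> f0 AB; rewrite (integral_mkcond A) (integral_mkcond B).
rewrite !ge0_integralTE; try by move=> x; exact: erestrict_ge0.
apply: le_ereal_sup => _ [h /= hA <-].
exists h => //= x; apply: (le_trans (hA x)).
rewrite /patch; case: ifPn => [|_]; last by case: ifPn.
by rewrite inE => /AB xB; rewrite mem_set.
Qed.

(** By uniqueness of Lebesgue measure it suffices to compare both sides on the intervals []a,
    b]]. *)
Lemma lebesgue_measure_scale (R : realType) (c : R) (A : set R) :
  (0 < c)%R -> measurable A ->
  lebesgue_measure A = c%:E * lebesgue_measure ( *%R c @^-1` A).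
Proof.
move=> c0 mA.
have mc : measurable_fun [set: measurableTypeR R]
    ( *%R c : measurableTypeR R -> measurableTypeR R).
  exact: measurable_funM.
pose nu : {measure set (measurableTypeR R) -> \bar R} :=
  measure_function_pushforward__canonical__measure_function_Measure
    (@lebesgue_measure R) mc.
pose k : {nonneg R} := NngNum (ltW c0).
apply: (@lebesgue_measure_unique _ (mscale k nu)) => // _ [[a b] _ <-] /=.
rewrite lebesgue_measure_itv /= /mscale /= /pushforward.
rewrite (_ : _ @^-1` _ = [set` `]a / c, b / c]%R]); last first.
  by apply/seteqP; split => x /=; rewrite !in_itv /= ltr_pdivrMr// ler_pdivlMr// mulrC.
rewrite lebesgue_measure_itv /= !lte_fin ltr_pM2r ?invr_gt0//.
case: ifPn => _; last by rewrite mule0.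
by rewrite -EFinM; congr EFin; field; rewrite gt_eqF.
Qed.

(** Each coordinate has its own factor, because Heisenberg dilations scale the central one by
    [r ^+ 2]. *)
Definition tscale (R : realType) (m : nat) (c : 'I_m -> R)
    (x : m.-tuple (measurableTypeR R)) : m.-tuple (measurableTypeR R) :=
  [tuple c i * tnth x i | i < m]%R.

Lemma measurable_tscale (R : realType) m (c : 'I_m -> R) :
  measurable_fun setT (tscale c).
Proof.
apply/measurable_fun_tnthP => i.
apply: (eq_measurable_fun (fun x : m.-tuple (measurableTypeR R) => (c i * tnth x i)%R)).
  by move=> x _; rewrite /= tnth_mktuple.
apply: measurable_funM => //; exact: measurable_tnth.
Qed.

(** Induction on the dimension: the measure of [A] is the integral of the measures of its slices
    over the first coordinate. Scaling that coordinate is a change of variable in the outer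
    integral, and the induction hypothesis scales the slices. *)
Lemma lebesgue_tuple_scale (R : realType) m (c : 'I_m -> R) A :
  (forall i, 0 < c i)%R -> measurable A ->
  lebesgue_tuple R m A = (\prod_i c i)%:E * lebesgue_tuple R m (tscale c @^-1` A).
Proof.
elim: m c A => [|m IH] c A c0 mA.
  rewrite big_ord0 mul1e /=; congr (dirac _ _).
  by apply/seteqP; split => x; rewrite /= (tuple0 x) (tuple0 (tscale _ _)).
pose c' (i : 'I_m) := c (lift ord0 i).
have mpre : measurable (@cons_pair _ (measurableTypeR R) m @^-1` A).
  by rewrite -[X in measurable X]setTI; exact: measurable_cons_pair.
have mpre' : measurable (@cons_pair _ (measurableTypeR R) m @^-1` (tscale c @^-1` A)).
  rewrite -comp_preimage -[X in measurable X]setTI.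
  have : measurable_fun setT (tscale c \o @cons_pair _ (measurableTypeR R) m).
    apply: measurableT_comp; [exact: measurable_tscale|exact: measurable_cons_pair].
  exact.
rewrite /lebesgue_tuple /= /cons_measure /pushforward /product_measure1.
pose mu := @lebesgue_measure R.
pose nu := lebesgue_tuple R m.
have mc : measurable_fun [set: measurableTypeR R]
    ( *%R (c ord0) : measurableTypeR R -> measurableTypeR R).
  exact: measurable_funM.
transitivity ((c ord0)%:E *
    \int[mu]_x (nu (xsection (@cons_pair _ (measurableTypeR R) m @^-1` A) (c ord0 * x)%R))).
  apply: (@ge0_integral_dilation _ _ _ mu ( *%R (c ord0)) (NngNum (ltW (c0 ord0))) setT
     (nu \o xsection (@cons_pair _ (measurableTypeR R) m @^-1` A))) => //=.
  - by move=> B mB; exact: lebesgue_measure_scale.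
  - exact: (@measurable_fun_xsection _ _ (measurableTypeR R) _ R nu _ mpre).
rewrite big_ord_recl EFinM -muleA; congr (_ * _).
rewrite -ge0_integralZl//; last 2 first.
- exact: (@measurable_fun_xsection _ _ (measurableTypeR R) _ R nu _ mpre').
- by rewrite lee_fin prodr_ge0// => i _; exact: ltW.
apply: eq_integral => x _.
rewrite /= /nu (IH c') //; [|by move=> i; exact: c0|exact: measurable_xsection].
congr (_ * lebesgue_tuple R m _).
(* Slicing commutes with scaling: the slice of [A] at [c ord0 * x], pulled back by [tscale c'], is
   the slice at [x] of the preimage of [A]. *)
have tE t : cons_pair ((c ord0 * x)%R, tscale c' t) = tscale c (cons_pair (x, t)).
  apply: eq_from_tnth => i; rewrite [RHS]tnth_mktuple.
  by have [j ->|->] := unliftP ord0 i; rewrite ?tnthS ?tnth_mktuple.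
apply/seteqP; split => t; rewrite /xsection /= !inE /= => At.
  exact: (eq_ind _ A At _ (tE t)).
exact: (eq_ind _ A At _ (esym (tE t))).
Qed.

(** * Measures homogeneous of degree Q under dilations *)

Section homogeneous_measure.
Context d (T : measurableType d) (R : realType) (mu : {measure set T -> \bar R}).
Context (h : T -> R) (dil : R -> T -> T) (Q : nat) (o : R).
Hypothesis h_ge0 : forall x, (0 <= h x)%R.
Hypothesis mh : measurable_fun setT h.
Hypothesis mdil : forall r, measurable_fun setT (dil r).
Hypothesis h_dil : forall (r : R) x, (0 < r)%R -> h (dil r x) = (r * h x)%R.
Hypothesis mu_dil : forall (r : R) A, (0 < r)%R -> measurable A ->
  mu A = (r ^+ Q)%:E * mu (dil r @^-1` A).
Hypothesis mu_unit_ball : mu [set x | (h x < 1)%R] = o%:E.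

(** * Weighted mass of shells and balls *)

(** Half-open, so that consecutive shells are disjoint and their union is again a shell. *)
Definition shell (a b : R) : set T := [set x | h x \in `[a, b[%R].

Definition shell_int (g a b : R) : \bar R := \int[mu]_(x in shell a b) (h x `^ g)%:E.

Lemma measurable_h_itv (i : interval R) : measurable [set x | h x \in i].
Proof.
rewrite -[X in measurable X]setTI.
exact: (mh measurableT (measurable_itv i)).
Qed.

Lemma measurable_shell a b : measurable (shell a b).
Proof. exact: measurable_h_itv. Qed.

Lemma measurable_h_lt r : measurable [set x | (h x < r)%R].
Proof.
have := measurable_h_itv `]-oo, r[%R.
by congr measurable; apply/seteqP; split => x /=; rewrite in_itv.
Qed.

Lemma measurable_h_powR (g : R) (D : set T) :
  measurable_fun D (fun x => (h x `^ g)%:E).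
Proof.
apply/measurable_EFinP; apply: measurable_funS (measurableT) _ _ => //.
exact: measurableT_comp (measurable_powR _) mh.
Qed.

Lemma dil_preimage_shell (r a b : R) : (0 < r)%R ->
  dil r @^-1` shell (r * a) (r * b) = shell a b.
Proof.
move=> r0; apply/seteqP; split => x;
  by rewrite /shell /= h_dil// !in_itv /= ler_pM2l// ltr_pM2l.
Qed.

(** The measure contributes degree [Q] and the weight degree [g]. *)
Lemma shell_int_scale (g r a b : R) : (0 < r)%R ->
  shell_int g (r * a) (r * b) = (r `^ (Q%:R + g))%:E * shell_int g a b.
Proof.
move=> r0; rewrite /shell_int.
rewrite (@ge0_integral_dilation _ _ _ mu (dil r) (NngNum (exprn_ge0 Q (ltW r0)))); last 5 first.
- exact: mdil.
- by move=> A mA; exact: mu_dil.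
- exact: measurable_shell.
- exact: measurable_h_powR.
- by move=> x _; rewrite lee_fin powR_ge0.
rewrite (dil_preimage_shell _ _ r0).
rewrite (eq_integral (fun x => (r `^ g)%:E * (h x `^ g)%:E)); last first.
  by move=> x _; rewrite (h_dil _ r0) powRM ?(ltW r0).
rewrite ge0_integralZl; last 4 first.
- exact: measurable_shell.
- exact: measurable_h_powR.
- by move=> x _; rewrite lee_fin powR_ge0.
- by rewrite lee_fin powR_ge0.
rewrite muleA -EFinM powRD; last by rewrite (gt_eqF r0) implybT.
by rewrite (powR_mulrn _ (ltW r0)).
Qed.

Lemma shell_intD (g a b c : R) : (a <= b <= c)%R ->
  shell_int g a c = shell_int g a b + shell_int g b c.
Proof.
move=> /andP[ab bc]; rewrite /shell_int -ge0_integral_setU//=; last 5 first.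
- exact: measurable_shell.
- exact: measurable_shell.
- exact: measurable_h_powR.
- by move=> x _; rewrite lee_fin powR_ge0.
- apply/eqP/seteqP; split => x //=; rewrite /shell /= !in_itv /= => -[/andP[_ xb]].
  by rewrite leNgt xb.
congr integral; apply/seteqP; split => x; rewrite /shell /= !in_itv /=.
  by move=> /andP[-> ->]; rewrite andbT /=; case: leP; [right|left].
by move=> [|] /andP[? ?]; apply/andP; split => //; lra.
Qed.

Lemma mu_h_lt (r : R) : (0 < r)%R -> mu [set x | (h x < r)%R] = (r ^+ Q * o)%:E.
Proof.
move=> r0; rewrite (mu_dil r0); last exact: measurable_h_lt.
rewrite EFinM -mu_unit_ball; congr (_ * mu _).
apply/seteqP; split => x /=; rewrite h_dil//;
  by rewrite -{2}(mulr1 r) ltr_pM2l.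
Qed.

Lemma mu_shell (a b : R) : (0 < a <= b)%R ->
  mu (shell a b) = ((b ^+ Q - a ^+ Q) * o)%:E.
Proof.
move=> /andP[a0 ab]; have b0 : (0 < b)%R by lra.
have -> : shell a b = [set x | (h x < b)%R] `\` [set x | (h x < a)%R].
  apply/seteqP; split => x; rewrite /shell /= in_itv /=.
    by move=> /andP[ax ->]; split=> //; apply/negP; rewrite -leNgt.
  by move=> [-> /negP]; rewrite -leNgt => ->.
rewrite measureD; last 3 first.
- exact: measurable_h_lt.
- exact: measurable_h_lt.
- by have := ltry (b ^+ Q * o); rewrite -(mu_h_lt b0).
rewrite setIidr; last by move=> x /= xa; lra.
apply: (etrans (congr2 (fun x y => x - y) (mu_h_lt b0) (mu_h_lt a0))).
by rewrite -EFinB mulrBl.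
Qed.

(** On this shell [- t <= ln (h x) <= 0], so [g * ln (h x)] has absolute value at most [|g| * t],
    whatever the sign of [g]. *)
Lemma shell_int_bounds (g t : R) : (0 <= t)%R ->
  (expR (- (`|g| * t)) * ((1 - expR (- t) ^+ Q) * o))%:E <= shell_int g (expR (- t)) 1
  <= (expR (`|g| * t) * ((1 - expR (- t) ^+ Q) * o))%:E.
Proof.
move=> t0.
have mst : mu (shell (expR (- t)) 1) = ((1 - expR (- t) ^+ Q) * o)%:E.
  by rewrite mu_shell ?expr1n// expR_gt0 expR_le1 oppr_le0.
have hg x : shell (expR (- t)) 1 x -> (expR (- (`|g| * t)) <= h x `^ g <= expR (`|g| * t))%R.
  rewrite /shell /= in_itv /= => /andP[xt x1].
  have hx : (0 < h x)%R by apply: lt_le_trans xt; exact: expR_gt0.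
  have lx : (`|ln (h x)| <= t)%R.
    have l0 : (ln (h x) <= 0)%R by apply: ln_le0; exact: ltW.
    by rewrite ler0_norm// lerNl -(expRK (- t)%R) ler_ln// posrE expR_gt0.
  rewrite /powR gt_eqF// !ler_expR -ler_norml normrM.
  by apply: ler_pM.
have cstE r : (r * ((1 - expR (- t) ^+ Q) * o))%:E = \int[mu]_(x in shell (expR (- t)) 1) r%:E.
  by rewrite EFinM -mst; exact: (esym (integral_cst mu (measurable_shell _ _) r%:E)).
rewrite !cstE; apply/andP; split; apply: ge0_le_integral => //;
  try (by move=> x _; rewrite lee_fin ?expR_ge0 ?powR_ge0);
  try exact: measurable_shell; try exact: measurable_h_powR.
- by move=> x /hg; rewrite lee_fin => /andP[].
- by move=> x /hg; rewrite lee_fin => /andP[].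
Qed.

Lemma unit_ball_measure_ge0 : (0 <= o)%R.
Proof. by rewrite -lee_fin -mu_unit_ball. Qed.

(** In the variable [t = - ln a] dilations become translations, which yields the additive functional
    equation for outer radius 1. The dilation by [b] then reaches a general outer radius. *)
Lemma shell_intE (g a b : R) : (0 < Q%:R + g)%R -> (0 < a <= b)%R ->
  shell_int g a b =
  (Q%:R * o / (Q%:R + g) * (b `^ (Q%:R + g) - a `^ (Q%:R + g)))%:E.
Proof.
move=> s0 /andP[a0 ab]; have b0 : (0 < b)%R by lra.
set s := (Q%:R + g)%R in s0 *.
pose G t := fine (shell_int g (expR (- t)) 1).
have GE t : (0 <= t)%R -> shell_int g (expR (- t)) 1 = (G t)%:E.
  move=> /(shell_int_bounds g) /andP[lb ub]; rewrite fineK// fin_numE.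
  by rewrite gt_eqF ?(lt_le_trans _ lb) ?ltNyr//= lt_eqF// (le_lt_trans ub) ?ltry.
have Gu := @radial_functional_equation _ G s `|g| Q%:R o s0 (normr_ge0 g) (ler0n _ _)
  unit_ball_measure_ge0.
have es t : ((expR (- t)) `^ s = expR (- (t * s)))%R by rewrite -expRM mulNr.
have {}Gu u : (0 <= u)%R -> G u = (Q%:R * o / s * (1 - expR (- (u * s))))%R.
  apply: Gu => [t v t0 v0|t t0].
    (* The shell is cut at radius [expR (- t)]; its inner piece is the dilate by [expR (- t)] of the
       shell from [expR (- v)] to 1. *)
    apply: EFin_inj; rewrite EFinD EFinM.
    rewrite -(GE _ (addr_ge0 t0 v0)) -(GE _ t0) -(GE _ v0).
    rewrite -es -shell_int_scale ?expR_gt0// mulr1 -expRD -opprD.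
    rewrite addeC; apply: shell_intD.
    by rewrite !ler_expR !lerN2 lerDl v0 expR_le1 oppr_le0.
  by have := shell_int_bounds g t0; rewrite GE// !lee_fin -(mulrN Q%:R) expRM_natl.
have u0 : (0 <= ln b - ln a)%R by rewrite subr_ge0 ler_ln.
have aE : a = (b * expR (- (ln b - ln a)))%R.
  by rewrite opprB expRD expRN !lnK ?posrE// mulrCA mulfV ?mulr1// gt_eqF.
have -> : shell_int g a b = shell_int g (b * expR (- (ln b - ln a))) (b * 1).
  by rewrite mulr1 -aE.
rewrite shell_int_scale// GE// Gu// -EFinM; congr EFin.
rewrite [in RHS]aE powRM ?expR_ge0 ?(ltW b0)// es -/s.
ring.
Qed.

(** Monotone convergence along shells increasing to the punctured ball; each obeys the bound, since
    the inner radius only contributes a subtracted term. *)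
Lemma ball_int_le (g r : R) : (0 < Q%:R + g)%R -> (0 < r)%R ->
  \int[mu]_(x in [set x | (0 < h x < r)%R]) (h x `^ g)%:E <=
  (Q%:R * o / (Q%:R + g) * r `^ (Q%:R + g))%:E.
Proof.
move=> s0 r0.
have -> : [set x | (0 < h x < r)%R] = \bigcup_k shell (r / k.+1%:R) r.
  apply/seteqP; split => x /=; last first.
    move=> [k _]; rewrite /shell /= in_itv /= => /andP[rx ->]; rewrite andbT.
    by apply: lt_le_trans rx; rewrite divr_gt0.
  move=> /andP[x0 xr].
  have [k rk] : exists k, (r / h x < k.+1%:R)%R.
    exists (Num.truncn (r / h x)); exact: truncnS_gt.
  exists k => //; rewrite /shell /= in_itv /= xr andbT.
  by rewrite ler_pdivrMr// mulrC -ler_pdivrMr// ltW.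
have cv := @ge0_nondecreasing_set_cvg_integral _ _ _ (fun k => shell (r / k.+1%:R) r)
  (fun x => (h x `^ g)%:E) mu.
apply: cvge_le (cv _ _ _ _).
- apply: nearW => k; have rk : (0 < r / k.+1%:R <= r)%R.
    by rewrite divr_gt0// ler_pdivrMr// ler_peMr ?ler1n// ltW.
  rewrite -/(shell_int _ _ _) shell_intE// lee_fin ler_wpM2l//.
    by rewrite divr_ge0 ?mulr_ge0 ?unit_ball_measure_ge0// ltW.
  by rewrite gerBl powR_ge0.
- apply/nondecreasing_seqP => k; apply/subsetPset => x.
  rewrite /shell /= !in_itv /= => /andP[rx ->]; rewrite andbT.
  by apply: le_trans rx; rewrite ler_wpM2l ?(ltW r0)// lef_pV2 ?posrE// ler_nat.
- by move=> k; exact: measurable_shell.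
- by move=> k; exact: measurable_h_powR.
- by move=> k x _; rewrite lee_fin powR_ge0.
Qed.

(** * The weak-type operator norm *)

Section operator_norm.
Context (al ga : R).
Hypothesis o_gt0 : (0 < o)%R.
Hypothesis Qga_gt0 : (0 < Q%:R + ga)%R.
Hypothesis al_ltQ : (al < Q%:R)%R.

(** The Hardy operator of an abstract norm; it unfolds to [hardy] when [h] is [hnorm] and [Q] is
    [hQ n]. *)
Definition averaging (f : T -> R) (x : T) : R :=
  ((h x `^ (Q%:R - al))^-1 * \int[mu]_(y in [set y | h y < h x]) f y)%R.

Let Qal_gt0 : (0 < Q%:R - al)%R. Proof. by rewrite subr_gt0. Qed.

(** The reciprocal of the exponent of the weak space. *)
Let expo := ((Q%:R - al) / (Q%:R + ga))%R.

Let expo_gt0 : (0 < expo)%R. Proof. by rewrite divr_gt0. Qed.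

(** This is omega_Q / (Q + gamma), as [o] is the volume of the unit ball. *)
Let cst := (Q%:R * o / (Q%:R + ga))%R.

Let cst_ge0 : (0 <= cst)%R.
Proof. by rewrite divr_ge0 ?mulr_ge0 ?(ltW o_gt0) ?(ltW Qga_gt0). Qed.

Lemma averaging_le (f : T -> R) (F : R) (x : T) :
  mu.-integrable setT (EFin \o f) -> \int[mu]_x `|(f x)%:E| = F%:E ->
  (`|averaging f x| <= (h x `^ (Q%:R - al))^-1 * F)%R.
Proof.
move=> intf fF; rewrite /averaging normrM ger0_norm ?invr_ge0 ?powR_ge0//.
apply: ler_wpM2l; first by rewrite invr_ge0 powR_ge0.
have mlt := measurable_h_lt (h x).
apply: (le_trans (le_normr_Rintegral mlt _)).
  by apply: integrableS intf => //; exact: measurableT.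
rewrite -lee_fin -fF /Rintegral fineK; last first.
  rewrite ge0_fin_numE ?integral_ge0//.
  apply: (@le_lt_trans _ _ (\int[mu]_x `|(f x)%:E|)); last by rewrite fF ltry.
  exact: ge0_integral_subset.
exact: ge0_integral_subset.
Qed.

(** The pointwise bound [averaging_le] is solved for [h x]. *)
Lemma averaging_level_set (f : T -> R) (F l : R) :
  mu.-integrable setT (EFin \o f) -> \int[mu]_x `|(f x)%:E| = F%:E ->
  (0 < F)%R -> (0 < l)%R ->
  [set x | (l < `|averaging f x|)%R] `<=`
  [set x | (0 < h x < (F / l) `^ (Q%:R - al)^-1)%R].
Proof.
move=> intf fF F0 l0 x /= lx.
have := lt_le_trans lx (averaging_le x intf fF).
have [hx0|hx0] := eqVneq (h x) 0%R.
  (* Here 0 `^ (Q - al) = 0 and 0^-1 = 0, so the operator vanishes. *)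
  by rewrite hx0 powR0 ?gt_eqF// invr0 mul0r ltNge (ltW l0).
have hx : (0 < h x)%R by rewrite lt_neqAle eq_sym hx0 h_ge0.
rewrite hx /= mulrC ltr_pdivlMr ?powR_gt0// mulrC -ltr_pdivlMr// => hl.
have hE : h x = ((h x `^ (Q%:R - al)) `^ (Q%:R - al)^-1)%R.
  by rewrite -powRrM mulfV ?powRr1// lt0r_neq0.
rewrite [X in (X < _)%R]hE.
by apply: gt0_ltr_powR; rewrite ?invr_gt0// nnegrE ?powR_ge0 ?divr_ge0 ?ltW.
Qed.

Lemma averaging_weak_bound (f : T -> R) (F : R) :
  mu.-integrable setT (EFin \o f) -> \int[mu]_x `|(f x)%:E| = F%:E -> (0 < F)%R ->
  weak_Lnorm mu (fun x => (h x `^ ga)%R) ((Q%:R + ga) / (Q%:R - al)) (averaging f)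
  <= (cst `^ expo * F)%:E.
Proof.
move=> intf fF F0; apply: ge_ereal_sup => _ [l /= l0 <-].
rewrite invf_div -/expo.
set r := ((F / l) `^ (Q%:R - al)^-1)%R.
have r0 : (0 < r)%R by rewrite powR_gt0// divr_gt0.
apply: (@le_trans _ _ (l%:E * (cst * r `^ (Q%:R + ga))%:E `^ expo)).
  rewrite lee_pmul2l// ?lte_fin//.
  apply: gt0_ler_poweR; rewrite ?(ltW expo_gt0)// ?in_itv/= ?leey ?andbT.
  - by apply: integral_ge0 => x _; rewrite lee_fin powR_ge0.
  - by rewrite lee_fin mulr_ge0 ?powR_ge0.
  apply: (le_trans _ (ball_int_le Qga_gt0 r0)).
  apply: ge0_integral_subset; first by move=> x; rewrite lee_fin powR_ge0.
  exact: averaging_level_set intf fF F0 l0.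
rewrite poweR_EFin -EFinM lee_fin powRM ?powR_ge0//.
(* The exponents cancel: the power of [r] becomes [F / l], and the bound no longer depends on
   [l]. *)
rewrite -!powRrM (_ : (Q%:R - al)^-1 * ((Q%:R + ga) * expo) = 1)%R; last first.
  by rewrite /expo; field; rewrite !gt_eqF.
rewrite powRr1 ?divr_ge0 ?(ltW F0) ?(ltW l0)//.
by rewrite mulrCA (mulrC F) mulVKf// gt_eqF.
Qed.

Lemma averaging_unit_ball (x : T) : (1 <= h x)%R ->
  averaging \1_[set y | (h y < 1)%R] x = (o / h x `^ (Q%:R - al))%R.
Proof.
move=> hx; rewrite /averaging mulrC; congr (_ / _)%R.
rewrite /Rintegral integral_indic; [|exact: measurable_h_lt|exact: measurable_h_lt].
rewrite setIidl; first by rewrite mu_unit_ball.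
by move=> y /= hy; exact: lt_le_trans hx.
Qed.

(** The shell from 1 to [r] has weighted mass [cst * u] times the power [s] of [r]. The power of [r]
    cancels against the level [l], and [u] close to 1 means [r] large. *)
Lemma averaging_weak_unit_ball (u : R) : (0 < u < 1)%R ->
  ((cst * u) `^ expo * o)%:E <=
  weak_Lnorm mu (fun x => (h x `^ ga)%R) ((Q%:R + ga) / (Q%:R - al))
    (averaging \1_[set y | (h y < 1)%R]).
Proof.
move=> /andP[u0 u1]; set s := (Q%:R + ga)%R; have s0 : (0 < s)%R := Qga_gt0.
have u1' : (0 < 1 - u)%R by rewrite subr_gt0.
(* [r] is chosen so that [r `^ s - 1 = u * r `^ s]. *)
pose r := ((1 - u)^-1 `^ s^-1)%R.
have r0 : (0 < r)%R by rewrite powR_gt0// invr_gt0.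
have rs : (r `^ s = (1 - u)^-1)%R.
  by rewrite -powRrM mulVf ?powRr1 ?invr_ge0 ?(ltW u1')// gt_eqF.
have r1 : (1 <= r)%R.
  have <- : (1 `^ s^-1 = 1 :> R)%R by rewrite powR1.
  apply: ge0_ler_powR; rewrite ?nnegrE ?invr_ge0 ?(ltW s0) ?(ltW u1')//.
  by rewrite invf_ge1//; lra.
(* The value of the operator where [h x = r]; it is strictly exceeded on the shell from 1 to [r]. *)
pose l := (o / r `^ (Q%:R - al))%R.
have l0 : (0 < l)%R by rewrite divr_gt0// powR_gt0.
apply: (@le_trans _ _ (l%:E * (shell_int ga 1 r) `^ expo)).
  rewrite shell_intE ?ltr01// -/s powR1 rs poweR_EFin -EFinM lee_fin -/cst.
  have -> : ((1 - u)^-1 - 1 = u * (1 - u)^-1)%R by field; rewrite gt_eqF.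
  have cu0 : (0 <= cst * u)%R by rewrite mulr_ge0// ltW.
  rewrite mulrA [leRHS](_ : _ = l * ((cst * u) `^ expo * (1 - u)^-1 `^ expo))%R; last first.
    by rewrite (powRM _ cu0) ?invr_ge0 ?(ltW u1').
  rewrite -rs -(powRrM r) (_ : s * expo = Q%:R - al)%R; last first.
    by rewrite /expo -/s mulrC divfK// lt0r_neq0.
  by rewrite /l mulrCA divfK// gt_eqF// powR_gt0.
rewrite /weak_Lnorm invf_div -/expo.
apply: (@le_trans _ _ (l%:E *
    (\int[mu]_(x in [set x | (l < `|averaging \1_[set y | (h y < 1)%R] x|)%R])
       (h x `^ ga)%:E) `^ expo)); last first.
  by apply: ereal_sup_ubound; exists l.
rewrite lee_pmul2l// ?lte_fin//.
apply: gt0_ler_poweR; rewrite ?(ltW expo_gt0)// ?in_itv/= ?leey ?andbT.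
- by apply: integral_ge0 => x _; rewrite lee_fin powR_ge0.
- by apply: integral_ge0 => x _; rewrite lee_fin powR_ge0.
apply: ge0_integral_subset; first by move=> x; rewrite lee_fin powR_ge0.
move=> x; rewrite /shell /= in_itv /= => /andP[x1 xr].
rewrite averaging_unit_ball// ger0_norm ?divr_ge0 ?powR_ge0 ?(ltW o_gt0)//.
have hx : (0 < h x)%R by exact: lt_le_trans x1.
rewrite /l ltr_pM2l// ltf_pV2 ?posrE; [|exact: powR_gt0|exact: powR_gt0].
by apply: gt0_ltr_powR; rewrite ?nnegrE ?(ltW hx) ?(ltW r0).
Qed.

Lemma opnorm_averaging :
  opnorm [set f : T -> R | f \in Lfun mu 1] (fun f => 'N[mu]_1[EFin \o f])
    (weak_Lnorm mu (fun x => (h x `^ ga)%R) ((Q%:R + ga) / (Q%:R - al))) averaging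
  = (cst `^ expo)%:E.
Proof.
apply/le_anti/andP; split.
  apply: ge_ereal_sup => _ [f /= [Lf +] <-].
  have intf : mu.-integrable setT (EFin \o f) by apply/Lfun1_integrable.
  rewrite Lnorm1 => /andP[N0 Noo].
  have fF : \int[mu]_x `|(f x)%:E| = (fine (\int[mu]_x `|(f x)%:E|))%:E.
    by rewrite fineK// ge0_fin_numE// ltW.
  have F0 : (0 < fine (\int[mu]_x `|(f x)%:E|))%R by rewrite -lte_fin -fF.
  rewrite fF inver gt_eqF// lee_pdivrMr// -EFinM.
  exact: averaging_weak_bound.
pose B : set T := [set y | (h y < 1)%R].
have mB : measurable B := measurable_h_lt 1%R.
have N1 : 'N[mu]_1[EFin \o (\1_B : T -> R)] = o%:E.
  rewrite Lnorm1 (eq_integral (fun x => (\1_B x)%:E)); last first.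
    by move=> x _; rewrite /= ger0_norm.
  by rewrite integral_indic// setIT.
set M := opnorm _ _ _ _.
have MB u : (0 < u < 1)%R -> ((cst * u) `^ expo)%:E <= M.
  move=> u01; apply: (@le_trans _ _ (weak_Lnorm mu (fun x => (h x `^ ga)%R)
    ((Q%:R + ga) / (Q%:R - al)) (averaging \1_B) / o%:E)).
    rewrite inver gt_eqF// lee_pdivlMr// -EFinM.
    exact: averaging_weak_unit_ball.
  apply: ereal_sup_ubound; exists (\1_B : T -> R); last by rewrite N1.
  split => /=; last by rewrite N1 lte_fin o_gt0 ltry.
  apply/Lfun1_integrable/integrableP; split; first exact/measurable_EFinP.
  by rewrite -Lnorm1 N1 ltry.
(* The sample value [u = 1 / 2] excludes [M = -oo] and shows that [m] is nonnegative. *)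
have h01 : (0 < 2^-1 :> R)%R && (2^-1 < 1 :> R)%R by apply/andP; split; lra.
case: M MB => [m| |] MB; last 2 first.
- by rewrite leey.
- by have := MB _ h01; rewrite leeNy_eq.
have m0 : (0 <= m)%R by rewrite -lee_fin (le_trans _ (MB _ h01))// lee_fin powR_ge0.
(* Comparing bases instead of powers makes the bound linear in [u = 1 - t], so [t] can tend to 0
   with error [t * cst]. *)
have mE : m = ((m `^ expo^-1) `^ expo)%R.
  by rewrite -powRrM mulVf ?powRr1// lt0r_neq0.
rewrite lee_fin mE; apply: ge0_ler_powR; rewrite ?nnegrE ?powR_ge0 ?(ltW expo_gt0)//.
apply: (@ler_addgt0_lin _ _ _ cst 2^-1%R) => // t t0 t2.
have u01 : (0 < 1 - t < 1)%R by lra.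
have c0 : (0 <= cst * (1 - t))%R by rewrite mulr_ge0//; lra.
have : (cst * (1 - t) <= m `^ expo^-1)%R.
  have cE : (cst * (1 - t))%R = (((cst * (1 - t)) `^ expo) `^ expo^-1)%R.
    by rewrite -powRrM mulfV ?powRr1// lt0r_neq0.
  rewrite cE; apply: ge0_ler_powR; rewrite ?nnegrE ?powR_ge0 ?invr_ge0 ?(ltW expo_gt0)//.
  by rewrite -lee_fin; exact: MB.
lra.
Qed.

End operator_norm.

End homogeneous_measure.

(** * The Heisenberg group *)

Definition dil (R : realType) (n : nat) (r : R) : Heis R n -> Heis R n :=
  tscale (fun i => if i == ord_max then r ^+ 2 else r)%R.

Lemma hnorm_ge0 (R : realType) n (x : Heis R n) : (0 <= hnorm x)%R.
Proof. exact: powR_ge0. Qed.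

(** Both terms under the fourth root are homogeneous of degree 4. *)
Lemma hnorm_dil (R : realType) n (r : R) (x : Heis R n) :
  (0 <= r)%R -> hnorm (dil r x) = (r * hnorm x)%R.
Proof.
move=> r0; rewrite /hnorm.
have rE : (r = (r ^+ 4) `^ 4^-1)%R.
  by rewrite -powR_mulrn// -powRrM mulfV ?powRr1// pnatr_eq0.
rewrite [X in _ = (X * _)%R]rE -powRM ?exprn_ge0//; last by rewrite addr_ge0 ?sqr_ge0.
congr (_ `^ _)%R.
rewrite /hcoord /dil !tnth_mktuple eqxx mulrDr.
rewrite (eq_bigr (fun i : 'I_(2 * n) =>
    r ^+ 2 * tnth x (widen_ord (leqnSn _) i) ^+ 2)%R); last first.
  move=> i _; rewrite tnth_mktuple ifF ?exprMn//.
  by apply/negbTE; rewrite -val_eqE /= neq_ltn ltn_ord.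
by rewrite -mulr_sumr; ring.
Qed.

Lemma measurable_hnorm (R : realType) n : measurable_fun setT (@hnorm R n).
Proof.
have mc i : measurable_fun setT (fun x : Heis R n => hcoord x i).
  exact: measurable_tnth.
apply: (measurableT_comp (measurable_powR _)).
apply: measurable_funD; apply: measurable_funX => //.
by apply: measurable_sum => i; exact: measurable_funX.
Qed.

Lemma measurable_hnorm_itv (R : realType) n (i : interval R) :
  measurable [set x : Heis R n | hnorm x \in i].
Proof.
rewrite -[X in measurable X]setTI.
exact: (measurable_hnorm measurableT (measurable_itv i)).
Qed.

(** The [2 * n] horizontal coordinates contribute [r] each and the central one [r ^+ 2]. *)
Lemma haar_dil (R : realType) n (r : R) (A : set (Heis R n)) :
  (0 < r)%R -> measurable A ->
  haar R n A = (r ^+ hQ n)%:E * haar R n (dil r @^-1` A).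
Proof.
move=> r0 mA.
rewrite /haar (lebesgue_tuple_scale (c := fun i => if i == ord_max then r ^+ 2 else r)%R)//.
  congr (_%:E * _); rewrite big_ord_recr /= eqxx (eq_bigr (fun=> r)).
    by rewrite prodr_const card_ord -exprD.
  by move=> i _; rewrite ifF//; apply/negbTE; rewrite -val_eqE /= neq_ltn ltn_ord.
by move=> i; case: ifP => // _; exact: exprn_gt0.
Qed.

(** Removing the root turns membership in the unit ball into a polynomial inequality. *)
Lemma hnorm_lt1 (R : realType) n (x : Heis R n) :
  (hnorm x < 1)%R = ((\sum_(i < 2 * n) hcoord x (widen_ord (leqnSn _) i) ^+ 2) ^+ 2
    + hcoord x ord_max ^+ 2 < 1)%R.
Proof.
have E : (1 `^ 4^-1 = 1 :> R)%R by rewrite powR1.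
rewrite /hnorm -[X in (_ `^ _ < X)%R]E.
apply/idP/idP; last first.
  apply: gt0_ltr_powR; rewrite ?invr_gt0 ?nnegrE ?addr_ge0 ?sqr_ge0//.
rewrite !ltNge; apply: contra => ?; apply: ge0_ler_powR;
  by rewrite ?invr_ge0 ?nnegrE ?addr_ge0 ?sqr_ge0.
Qed.

(** * Finiteness and positivity of the unit ball volume *)

Lemma haar_box (R : realType) n (d : R) : (0 <= d)%R ->
  haar R n [set x | forall i, tnth x i \in `[- d, d]%R] = ((2 * d) ^+ (2 * n).+1)%:E.
Proof.
move=> d0; rewrite /haar /lebesgue_tuple.
rewrite (tuple_measure_box (@lebesgue_measure R) (A := fun=> [set` `[- d, d]%R]))//.
rewrite (eq_bigr (fun=> (2 * d)%:E)) => [|i _].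
  by rewrite prodEFin prodr_const card_ord.
rewrite [LHS](lebesgue_measure_itv `[- d, d]%R) /= lte_fin -EFinB.
by case: ltP => [_|dd]; congr EFin; lra.
Qed.

Lemma measurable_box (R : realType) n (d : R) :
  measurable [set x : Heis R n | forall i, tnth x i \in `[- d, d]%R].
Proof.
rewrite (_ : [set x | _] =
    \bigcap_(i in setT) (fun x : Heis R n => tnth x i) @^-1` [set` `[- d, d]%R]).
  apply: fin_bigcap_measurable => // i _.
  by rewrite -[X in measurable X]setTI; exact: (measurable_tnth i measurableT).
by apply/seteqP; split => x /= H i; [move=> _; exact: H|exact: H].
Qed.

Lemma measurable_hball (R : realType) n : measurable (@hball R n).
Proof.
have := @measurable_hnorm_itv R n `]-oo, 1[%R.
by congr measurable; apply/seteqP; split => x /=; rewrite in_itv.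
Qed.

(** The ball lies in the cube of half-side 1: the horizontal squares have sum below 1, because the
    square of that sum is, and the central square is below 1. *)
Lemma OmegaQ_lty (R : realType) n : OmegaQ R n < +oo.
Proof.
apply: (@le_lt_trans _ _ (haar R n [set x | forall i, tnth x i \in `[- 1, 1]%R])); last first.
  by rewrite haar_box// ltry.
apply: le_measure; rewrite ?inE.
- exact: measurable_hball.
- exact: measurable_box.
- move=> x; rewrite /hball /= hnorm_lt1 => H i.
  have S0 : (0 <= \sum_(i < 2 * n) hcoord x (widen_ord (leqnSn _) i) ^+ 2)%R.
    by apply: sumr_ge0 => j _; exact: sqr_ge0.
  suff : (hcoord x i ^+ 2 < 1)%R.
    by rewrite /hcoord in_itv /=; set y := tnth x i => ?; nra.
  have [j ->|->] := unliftP ord_max i; last first.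
    by apply: le_lt_trans H; rewrite lerDr sqr_ge0.
  have : (\sum_(i < 2 * n) hcoord x (widen_ord (leqnSn _) i) ^+ 2 < 1)%R.
    by have := sqr_ge0 (hcoord x ord_max); nra.
  apply: le_lt_trans.
  have -> : lift ord_max j = widen_ord (leqnSn _) j.
    by apply: val_inj; rewrite /= /bump leqNgt ltn_ord.
  by rewrite (bigD1 j)//= lerDl sumr_ge0// => k _; exact: sqr_ge0.
Qed.

Lemma OmegaQ_gt0 (R : realType) n : 0 < OmegaQ R n.
Proof.
(* The box of half-side [1 / Q] lies in the unit ball. *)
pose d : R := ((hQ n)%:R^-1)%R.
have d0 : (0 < d)%R by rewrite invr_gt0 ltr0n /hQ addn2.
apply: (@lt_le_trans _ _ (haar R n [set x | forall i, tnth x i \in `[- d, d]%R])).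
  by rewrite haar_box ?ltW// lte_fin exprn_gt0// mulr_gt0.
apply: le_measure; rewrite ?inE; [exact: measurable_box|exact: measurable_hball|].
move=> x /= xd; rewrite /hball /= hnorm_lt1.
(* This gives [d <= 1 / 2] and a horizontal sum of at most [d * (1 - 2 * d) <= 1 / 2]; both squares
   are then at most [1 / 4]. *)
have dE : ((2 * n)%:R * d + 2 * d = 1)%R.
  by rewrite -mulrDl -natrD mulfV// pnatr_eq0 /hQ addn2.
have x2 i : (hcoord x i ^+ 2 <= d ^+ 2)%R.
  by have := xd i; rewrite /hcoord in_itv /= => /andP[]; set y := tnth x i => ? ?; nra.
have nd0 : (0 <= (2 * n)%:R * d)%R by rewrite mulr_ge0 ?ler0n// ltW.
have : (\sum_(i < 2 * n) hcoord x (widen_ord (leqnSn _) i) ^+ 2 <= (2 * n)%:R * d ^+ 2)%R.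
  rewrite (le_trans (ler_sum _ (fun i _ => x2 _)))// sumr_const card_ord.
  by rewrite mulr_natl.
have : (0 <= \sum_(i < 2 * n) hcoord x (widen_ord (leqnSn _) i) ^+ 2)%R.
  by apply: sumr_ge0 => j _; exact: sqr_ge0.
have := x2 ord_max; set S := (\sum_(i < _) _)%R; set y := hcoord _ _ => y2 S0 S1.
have : (S <= 2^-1)%R by nra.
by nra.
Qed.

(** * The sharp constant on the Heisenberg group *)

Theorem theorem2p2 (R : realType) (n : nat) (alpha gamma : R)
    (n_ge1 : (1 <= n)%N)
    (Qgamma_gt0 : (0 < (hQ n)%:R + gamma)%R)
    (alpha_gt0 : (0 < alpha)%R) (alpha_ltQ : (alpha < (hQ n)%:R)%R) :
  opnorm [set f : Heis R n -> R | f \in Lfun (haar R n) 1]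
    (fun f => 'N[haar R n]_1[EFin \o f])
    (weak_Lnorm (haar R n) (fun x => (hnorm x `^ gamma)%R)
      (((hQ n)%:R + gamma) / ((hQ n)%:R - alpha)))
    (hardy alpha)
  = (omegaQ R n / ((hQ n)%:R + gamma)%:E)
    `^ (((hQ n)%:R - alpha) / ((hQ n)%:R + gamma)).
Proof.
have Ofin : OmegaQ R n \is a fin_num.
  by rewrite ge0_fin_numE ?measure_ge0// OmegaQ_lty.
have OE : haar R n [set x | (hnorm x < 1)%R] = (fine (OmegaQ R n))%:E.
  by rewrite fineK.
have O0 : (0 < fine (OmegaQ R n))%R.
  by rewrite fine_gt0// OmegaQ_gt0 OmegaQ_lty.
have h_dil (r : R) (x : Heis R n) : (0 < r)%R -> hnorm (dil r x) = (r * hnorm x)%R.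
  by move=> r0; exact: hnorm_dil (ltW r0).
have E := @opnorm_averaging _ (Heis R n) R (haar R n) (@hnorm R n) (@dil R n) (hQ n)
  (fine (OmegaQ R n)) (@hnorm_ge0 R n) (@measurable_hnorm R n)
  (fun r => measurable_tscale _) h_dil (@haar_dil R n) OE alpha gamma O0 Qgamma_gt0 alpha_ltQ.
transitivity ((((hQ n)%:R * fine (OmegaQ R n) / ((hQ n)%:R + gamma))
  `^ (((hQ n)%:R - alpha) / ((hQ n)%:R + gamma)))%:E); first exact: E.
(* Finiteness of [OmegaQ] reduces the extended-real quotient to the real one. *)
rewrite -poweR_EFin; congr (_ `^ _).
rewrite /omegaQ inver gt_eqF//.
by rewrite -[in RHS](fineK Ofin) -!EFinM.
Qed.
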